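(* Let $\ell\ge 1$ and let $V_\ell\subset\mathbb{A}^{2\ell+1}$ be the affine variety with coordinates $b,x_1,y_1,\dots,x_\ell,y_\ell$ defined by the $\ell$ equations $x_i^2+y_i^2=x_{i+1}+b\,y_{i+1}$ for $i=1,\dots,\ell-1$ and $x_\ell^2+y_\ell^2=x_1+b\,y_1$ (for $\ell=1$ this is the single equation $x_1^2+y_1^2=x_1+by_1$). Let $P=(b_0,\mathbf{x}_1,\mathbf{y}_1,\dots,\mathbf{x}_\ell,\mathbf{y}_\ell)$ be any point of $V_\ell$ with coordinates in $\mathbb{C}$. Then the line in $\mathbb{A}^{2\ell+1}$ given parametrically by $$b(t)=b_0+(b_0^2+1)t,\qquad x_i(t)=\mathbf{x}_i+(\mathbf{x}_ib_0-\mathbf{y}_i)t,\qquad y_i(t)=\mathbf{y}_i+(\mathbf{y}_ib_0+\mathbf{x}_i)t\quad(i=1,\dots,\ell)$$ passes through $P$ and is entirely contained in $V_\ell$. Moreover, if $P$ has integer coordinates and corresponds to a propagating $\ell$-cycle of $S_{x^2,b_0}$, then for every non-negative integer $\mathbf{t}$, the integer point $P(\mathbf{t})=(b(\mathbf{t}),x_1(\mathbf{t}),y_1(\mathbf{t}),\dots,x_\ell(\mathbf{t}),y_\ell(\mathbf{t}))$ corresponds to a propagating $\ell$-cycle of $S_{x^2,b(\mathbf{t})}$.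
   Context: For an integer $b\ge2$ and a map $\phi$ from $\{0,\dots,b-1\}$ to $\mathbb{Z}_{\ge0}$, define $S_{\phi,b}:\mathbb{Z}_{\ge0}\to\mathbb{Z}_{\ge0}$ by $S_{\phi,b}(n)=\phi(x_0)+\dots+\phi(x_d)$, where $n=x_0+x_1b+\dots+x_db^d$ is the base-$b$ expansion of $n$ ($0\le x_i<b$). A cycle of length $\ell$ (an $\ell$-cycle) of $S_{\phi,b}$ is a sequence of pairwise distinct positive integers $\mathrm{cyc}(n_1,\dots,n_\ell)$ with $S_{\phi,b}(n_i)=n_{i+1}$ for $1\le i<\ell$ and $S_{\phi,b}(n_\ell)=n_1$, considered up to cyclic permutation. Here $\phi(x)=x^2$. An $\ell$-cycle $\mathrm{cyc}(n_1,\dots,n_\ell)$ of $S_{x^2,b}$ is propagating if every $n_i$ has at most two base-$b$ digits and $b$ divides no $n_i$. Writing $n_i=\mathbf{x}_i+\mathbf{y}_ib$ with $0\le\mathbf{x}_i,\mathbf{y}_i\le b-1$ and $\mathbf{x}_i\neq0$, a propagating $\ell$-cycle of $S_{x^2,b}$ corresponds to the integer point $(b,\mathbf{x}_1,\mathbf{y}_1,\dots,\mathbf{x}_\ell,\mathbf{y}_\ell)$ of $V_\ell$; conversely, an integer point of $V_\ell$ with $0\le\mathbf{x}_i,\mathbf{y}_i\le b-1$ and $\mathbf{x}_i\ne0$ is said to correspond to the cycle $\mathrm{cyc}(\mathbf{x}_1+b\mathbf{y}_1,\dots,\mathbf{x}_\ell+b\mathbf{y}_\ell)$. *)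

(* Defs.v *)
From HB Require Import structures.
From mathcomp Require Import all_boot all_order all_algebra.
From mathcomp Require Import complex.
From mathcomp Require Import mathcomp_extra boolp classical_sets reals.

Set Implicit Arguments.
Unset Strict Implicit.
Unset Printing Implicit Defensive.

Import Order.TTheory GRing.Theory Num.Theory.

Local Open Scope classical_set_scope.
Local Open Scope ring_scope.

(* [trunc_log b n] is the largest e with b ^ e <= n (and 0 if n = 0), so the
   expansion has no leading zero, except that 0 has the single digit 0. *)
Definition ndigits (b n : nat) : nat := (trunc_log b n).+1.

Definition digit (b n i : nat) : nat := (n %/ b ^ i %% b)%N.

Lemma digit_lt (b n i : nat) : (1 < b)%N -> (digit b n i < b)%N.
Proof. by move=> b1; rewrite ltn_mod (ltn_trans _ b1). Qed.

Lemma digit_expansion (b n : nat) : (1 < b)%N ->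
  n = (\sum_(i < ndigits b n) digit b n i * b ^ i)%N.
Proof.
move=> b1; have aux k : (n %% b ^ k = \sum_(i < k) digit b n i * b ^ i)%N.
  elim: k => [|k IH]; first by rewrite big_ord0 modn1.
  rewrite big_ord_recr /= -IH /digit expnSr addnC.
  rewrite {1}(divn_eq n (b ^ k)) {1}(divn_eq (n %/ b ^ k) b) mulnDl.
  rewrite -mulnA (mulnC b) -addnA modnMDl modn_small //.
  have bk : (0 < b ^ k)%N by rewrite expn_gt0 ltnW.
  apply: (@leq_trans ((n %/ b ^ k %% b).+1 * b ^ k)).
    by rewrite mulSn addnC ltn_add2r ltn_mod.
  by rewrite mulnC leq_mul2l digit_lt ?orbT.
by rewrite -aux modn_small // trunc_log_ltn.
Qed.

(* Only the values of phi on {0, ..., b - 1} matter, by [digit_lt]. *)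
Definition digit_map (phi : nat -> nat) (b n : nat) : nat :=
  (\sum_(i < ndigits b n) phi (digit b n i))%N.

(* [ordS] is the cyclic successor: ordS i = i + 1 mod l.  A cycle is given by
   one of its representatives; this predicate is invariant under rotation. *)
Definition is_cycle (f : nat -> nat) (l : nat) (n : 'I_l -> nat) : Prop :=
  [/\ injective n, forall i, (0 < n i)%N & forall i, f (n i) = n (ordS i)].

Definition propagating_cycle (b l : nat) (n : 'I_l -> nat) : Prop :=
  [/\ is_cycle (digit_map (fun x => x ^ 2)%N b) n,
      forall i, (ndigits b (n i) <= 2)%N
    & forall i, ~~ (b %| n i)%N].

(* Points of affine (2 l + 1)-space, with coordinates b, x_i, y_i. *)
Record apoint (K : Type) (l : nat) := APoint {
  cb : K;
  cx : {ffun 'I_l -> K};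
  cy : {ffun 'I_l -> K}
}.

Definition map_apoint (K L : Type) (f : K -> L) (l : nat) (P : apoint K l) :
    apoint L l :=
  APoint (f (cb P)) [ffun i => f (cx P i)] [ffun i => f (cy P i)].

Definition V (K : comNzRingType) (l : nat) : set (apoint K l) :=
  [set P | forall i : 'I_l,
     cx P i ^+ 2 + cy P i ^+ 2 = cx P (ordS i) + cb P * cy P (ordS i)].

Definition line_at (K : comNzRingType) (l : nat) (P : apoint K l) (t : K) :
    apoint K l :=
  APoint (cb P + (cb P ^+ 2 + 1) * t)
        [ffun i => cx P i + (cx P i * cb P - cy P i) * t]
        [ffun i => cy P i + (cy P i * cb P + cx P i) * t].

Definition line (K : comNzRingType) (l : nat) (P : apoint K l) :
    set (apoint K l) :=
  range (line_at P).

Definition corresponds (b l : nat) (P : apoint int l) (n : 'I_l -> nat) :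
    Prop :=
  [/\ V P,
      cb P = b%:Z,
      forall i, 0 <= cx P i <= b%:Z - 1 /\ 0 <= cy P i <= b%:Z - 1,
      forall i, cx P i <> 0
    & forall i, (n i)%:Z = cx P i + b%:Z * cy P i].

(* The base b is the b-coordinate of P, as imposed by [corresponds]. *)
Definition corresponds_to_propagating_cycle (l : nat) (P : apoint int l) :
    Prop :=
  exists (b : nat) (n : 'I_l -> nat),
    [/\ (2 <= b)%N, propagating_cycle b n & corresponds b P n].

(* Main.v *)
(** Put z_i = x_i + i y_i.  The point of parameter t on the line has
    z_i(t) = (1 + b t + i t) z_i, so both sides of every equation of V are
    multiplied by c = (1 + b t)^2 + t^2: the norms x_i^2 + y_i^2 clearly, and
    the numbers n_i = x_i + b y_i by a direct computation.  When P is an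
    integer point in the digit range with x_i <> 0, so is P(t) for t >= 0, and
    an integer point of V in that range gives a propagating cycle as soon as
    the n_i are distinct; here they are c times the original ones. *)

Require Import Defs.
From HB Require Import structures.
From mathcomp Require Import all_boot all_order all_algebra.
From mathcomp Require Import complex.
From mathcomp Require Import ring zify.
From mathcomp Require Import mathcomp_extra boolp classical_sets reals.

Import Order.TTheory GRing.Theory Num.Theory.

Local Open Scope classical_set_scope.
Local Open Scope ring_scope.

Lemma line_at_value (K : comNzRingType) (l : nat) (P : apoint K l) (t : K)
    (i : 'I_l) :
  cx (line_at P t) i + cb (line_at P t) * cy (line_at P t) i =
  (cx P i + cb P * cy P i) * ((1 + cb P * t) ^+ 2 + t ^+ 2).
Proof. by rewrite /= !ffunE; ring. Qed.

Lemma line_at_norm (K : comNzRingType) (l : nat) (P : apoint K l) (t : K)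
    (i : 'I_l) :
  cx (line_at P t) i ^+ 2 + cy (line_at P t) i ^+ 2 =
  (cx P i ^+ 2 + cy P i ^+ 2) * ((1 + cb P * t) ^+ 2 + t ^+ 2).
Proof. by rewrite /= !ffunE; ring. Qed.

Lemma line_at_V (K : comNzRingType) (l : nat) (P : apoint K l) (t : K) :
  V P -> V (line_at P t).
Proof. by move=> VP i; rewrite line_at_norm VP -line_at_value. Qed.

Lemma line_at0 (K : comNzRingType) (l : nat) (P : apoint K l) :
  line_at P 0 = P.
Proof.
by case: P => b x y; congr APoint => /=; try apply/ffunP => i;
   rewrite ?ffunE /= mulr0 addr0.
Qed.

(** The coordinates of [line_at] are integer polynomials in those of [P] and in [t]. With [f] the
    map [intr], this identifies the complex point of integer parameter with the integer one. *)
Lemma map_line_at (K L : comNzRingType) (f : {rmorphism K -> L}) (l : nat)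
    (P : apoint K l) (t : K) :
  map_apoint f (line_at P t) = line_at (map_apoint f P) (f t).
Proof.
congr APoint => /=; try apply/ffunP => i; rewrite ?ffunE /=.
- by rewrite rmorphD rmorphM rmorphD rmorphXn rmorph1.
- by rewrite rmorphD rmorphM rmorphB rmorphM.
- by rewrite rmorphD rmorphM rmorphD rmorphM.
Qed.

Lemma ndigits_two (b x y : nat) : (1 < b)%N -> (x < b)%N -> (y < b)%N ->
  ndigits b (x + b * y) = if y == 0%N then 1%N else 2%N.
Proof.
move=> b1 xb yb; rewrite /ndigits; case: eqP => y0; congr (_.+1).
  (* For x = y = 0 the bounds of [trunc_log_eq] fail, and the default value [trunc_log b 0 = 0]
     gives the single digit. *)
  case: x xb => [|x] xb; first by rewrite y0 muln0 trunc_log0.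
  by apply: trunc_log_eq => //; rewrite expn0 expn1; nia.
by apply: trunc_log_eq => //; rewrite expn1 expnS expn1; nia.
Qed.

(** If y = 0 the expansion stops at x and the sum has no term for y; [phi 0 = 0] makes both cases
    agree. *)
Lemma digit_map_two (phi : nat -> nat) (b x y : nat) : phi 0%N = 0%N ->
  (1 < b)%N -> (x < b)%N -> (y < b)%N ->
  digit_map phi b (x + b * y) = (phi x + phi y)%N.
Proof.
move=> phi0 b1 xb yb; rewrite /digit_map ndigits_two //.
have d0 : digit b (x + b * y) 0 = x.
  by rewrite /digit expn0 divn1 addnC mulnC modnMDl modn_small.
have d1 : digit b (x + b * y) 1 = y.
  rewrite /digit expn1 addnC mulnC divnMDl ?(ltn_trans _ b1) //.
  by rewrite divn_small // addn0 modn_small.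
case: eqP => [y0|_]; rewrite !big_ord_recl big_ord0 /= ?lift0 d0 ?addn0.
  by rewrite y0 phi0 addn0.
by rewrite /bump /= d1.
Qed.

Lemma propagating_of_corresponds (b l : nat) (P : apoint int l)
    (n : 'I_l -> nat) :
  (1 < b)%N -> injective n -> corresponds b P n -> propagating_cycle b n.
Proof.
move=> b1 n_inj [VP bP rg x0 nP].
have digits i : exists x y : nat, [/\ cx P i = x%:Z, cy P i = y%:Z,
    [/\ (0 < x)%N, (x < b)%N & (y < b)%N] & n i = (x + b * y)%N].
  have [/andP[hx hx'] /andP[hy hy']] := rg i.
  exists `|cx P i|%N, `|cy P i|%N.
  move: (x0 i) (nP i); set X := cx P i in hx hx' *; set Y := cy P i in hy hy' *.
  by move=> X0 nXY; split; [lia | lia | split; lia | nia].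
split.
- split=> // i.
    by have [x [y [_ _ [x_gt0 _ _] ->]]] := digits i; rewrite addn_gt0 x_gt0.
  (* The right-hand side of the equation of [V] is the value of [n] at [ordS i], the left-hand side
     the digit map at [n i]. *)
  have := VP i; rewrite bP -nP.
  have [x [y [-> -> [_ xb yb] ->]]] := digits i.
  by rewrite digit_map_two // -!mulnn !expr2; lia.
- move=> i; have [x [y [_ _ [_ xb yb] ->]]] := digits i.
  by rewrite ndigits_two //; case: eqP.
- move=> i; have [x [y [_ _ [x_gt0 xb _] ->]]] := digits i.
  by rewrite dvdn_addl ?dvdn_mulr // gtnNdvd.
Qed.

(** Since 1 <= x <= b - 1 and 0 <= y <= b - 1, the slopes x b - y and y b + x lie between 0 and b^2
    + 1, the slope of the base. Hence the bounds valid at t = 0 persist for t >= 0. *)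
Lemma digits_line_at (b x y t : int) :
  0 < x < b -> 0 <= y < b -> 0 <= t ->
  0 < x + (x * b - y) * t < b + (b ^+ 2 + 1) * t /\
  0 <= y + (y * b + x) * t < b + (b ^+ 2 + 1) * t.
Proof.
move=> /andP[x0 xb] /andP[y0 yb] t0.
(* These products bound the monomials x b and y b, which [lia] then treats as atoms. *)
have xb_ge : 0 <= (x - 1) * b by apply: mulr_ge0; lia.
have xb_le : 0 <= (b - x) * b by apply: mulr_ge0; lia.
have yb_ge : 0 <= y * b by apply: mulr_ge0; lia.
have yb_le : 0 <= (b - 1 - y) * b by apply: mulr_ge0; lia.
have u_ge : 0 <= (x * b - y) * t by apply: mulr_ge0; lia.
have u_le : 0 <= (b ^+ 2 + 1 - (x * b - y)) * t by apply: mulr_ge0; lia.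
have v_ge : 0 <= (y * b + x) * t by apply: mulr_ge0; lia.
have v_le : 0 <= (b ^+ 2 + 1 - (y * b + x)) * t by apply: mulr_ge0; lia.
by split; apply/andP; split; lia.
Qed.

Lemma line_at_corresponds (b l : nat) (P : apoint int l) (n : 'I_l -> nat)
    (t : nat) :
  corresponds b P n ->
  corresponds (b + (b ^ 2 + 1) * t) (line_at P t%:Z)
    (fun i => n i * ((1 + b * t) ^ 2 + t ^ 2))%N.
Proof.
move=> [VP bP rg x0 nP].
have bt : cb (line_at P t%:Z) = (b + (b ^ 2 + 1) * t)%:Z by rewrite /= bP; lia.
have digits_t i : 0 < cx P i + (cx P i * b%:Z - cy P i) * t%:Z
                    < b%:Z + (b%:Z ^+ 2 + 1) * t%:Z /\
    0 <= cy P i + (cy P i * b%:Z + cx P i) * t%:Z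
      < b%:Z + (b%:Z ^+ 2 + 1) * t%:Z.
  by have := rg i; have := x0 i => xn0 rgi; apply: digits_line_at; lia.
split=> // [|i|i|i].
- exact: line_at_V.
- by rewrite -bt /= !ffunE bP; have := digits_t i; lia.
- by rewrite /= !ffunE bP; have := digits_t i; lia.
- by rewrite -bt line_at_value bP -nP; lia.
Qed.

Theorem theorem2p4 (R : realType) (l : nat) (hl : (1 <= l)%N)
    (P : apoint R[i] l) (hP : V P) :
  line P P /\ line P `<=` @V R[i] l /\
  (forall P0 : apoint int l,
     P = map_apoint intr P0 ->
     corresponds_to_propagating_cycle P0 ->
     forall t : nat,
       line_at P t%:R = map_apoint intr (line_at P0 t%:Z) /\
       corresponds_to_propagating_cycle (line_at P0 t%:Z)).
Proof.
split; first by exists 0 => //; rewrite line_at0.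
split; first by move=> _ [t _ <-]; apply: line_at_V.
move=> P0 PE [b [n [b2 [[n_inj _ _] _ _] Pn]]] t.
split; first by rewrite PE map_line_at.
have Ptn := line_at_corresponds _ _ _ _ t Pn.
exists (b + (b ^ 2 + 1) * t)%N, (fun i => n i * ((1 + b * t) ^ 2 + t ^ 2))%N.
have bt2 : (2 <= b + (b ^ 2 + 1) * t)%N by rewrite (leq_trans b2) ?leq_addr.
(* Distinctness survives because the common factor (1 + b t)^2 + t^2 is positive. *)
split=> //; apply: propagating_of_corresponds Ptn => // i j /eqP.
by rewrite eqn_pmul2r ?addn_gt0 ?expn_gt0 // => /eqP /n_inj.
Qed.
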